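(* Let $(M,\omega)$ be a connected symplectic manifold (open or closed). For every pair $(F,G)\in C_c^\infty(M)\times C_c^\infty(M)$ the function $s\mapsto s\,\rho_{F,G}(s)$ is Lipschitz on $(0,+\infty)$ with Lipschitz constant $3\min(\|F\|,\|G\|)$.
   Context: $C^\infty_c(M)$ is the space of smooth compactly supported real functions on $M$ with the norm $\|F\|=\max_M|F|$; $\mathcal F=C_c^\infty(M)\times C_c^\infty(M)$ carries the distance $d((F,G),(H,K))=\|F-H\|+\|G-K\|$. The Hamiltonian vector field of $F$ is given by $i_{\mathrm{sgrad}F}\,\omega=-dF$ and $\{F,G\}=\omega(\mathrm{sgrad}\,G,\mathrm{sgrad}\,F)$. For $s\ge 0$ let $\mathcal K_s=\{(H,K)\in\mathcal F:\|\{H,K\}\|\le s\}$. The profile function of $(F,G)$ is $\rho_{F,G}(s)=\inf_{(H,K)\in\mathcal K_s}d((F,G),(H,K))$ for $s\ge0$. *)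

(* Defs.v *)
From HB Require Import structures.
From mathcomp Require Import all_boot all_order all_algebra.
From mathcomp Require Import all_classical all_reals all_analysis.
Set Implicit Arguments.
Unset Strict Implicit.
Unset Printing Implicit Defensive.
Import Order.TTheory GRing.Theory Num.Theory.
Import numFieldNormedType.Exports.
Local Open Scope classical_set_scope.
Local Open Scope ring_scope.

(* The predicates below are meant for U open: then only the germs of f at the
   points of U matter, and the values of f outside U are irrelevant. *)
Fixpoint Ck_on {R : realType} {V W : normedModType R}
    (k : nat) (U : set V) (f : V -> W) : Prop :=
  match k with
  | 0 => forall x, U x -> {for x, continuous f}
  | k'.+1 => (forall x, U x -> differentiable f x) /\
             (forall v, Ck_on k' U ('D_v f))
  end.

Definition smooth_on {R : realType} {V W : normedModType R}
    (U : set V) (f : V -> W) : Prop := forall k, Ck_on k U f.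

(* chart_map and chart_inv are total functions, but they are meaningful only on
   chart_dom and on its image respectively. *)
Record chart (R : realType) (n : nat) (M : topologicalType) := Chart {
  chart_dom : set M;
  chart_map :> M -> 'rV[R]_n;
  chart_inv : 'rV[R]_n -> M;
  chart_dom_open : open chart_dom;
  chart_img_open : open (chart_map @` chart_dom);
  chart_mapK : forall p, chart_dom p -> chart_inv (chart_map p) = p;
  chart_map_continuous : forall p, chart_dom p -> {for p, continuous chart_map};
  chart_inv_continuous : forall x, (chart_map @` chart_dom) x ->
    {for x, continuous chart_inv} }.

Definition chart_img {R : realType} {n : nat} {M : topologicalType}
  (c : chart R n M) : set 'rV[R]_n := c @` chart_dom c.

(* Smooth manifolds without boundary.  The function chart_at selects a chart
   around every point p; the tangent space at p is 'rV[R]_n, a tangent vector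
   being represented by its coordinates in the chart chart_at p. *)
Record smoothManifold (R : realType) (n : nat) (M : topologicalType) :=
  SmoothManifold {
  manifold_hausdorff : hausdorff_space M;
  manifold_second_countable : @second_countable M;
  atlas : set (chart R n M);
  chart_at : M -> chart R n M;
  chart_at_atlas : forall p, atlas (chart_at p);
  chart_at_dom : forall p, chart_dom (chart_at p) p;
  atlas_compatible : forall c d, atlas c -> atlas d ->
    smooth_on (c @` (chart_dom c `&` chart_dom d)) (d \o chart_inv c) }.

Section manifold.
Context {R : realType} {n : nat} {M : topologicalType}.
Variable S : smoothManifold R n M.

Definition smooth_fun (F : M -> R) : Prop :=
  forall c, atlas S c -> smooth_on (chart_img c) (F \o chart_inv c).

Definition Cinfty_c : set (M -> R) :=
  [set F | smooth_fun F /\ compact (closure [set p | F p != 0])].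

Definition tangent_diff (F : M -> R) (p : M) (v : 'rV[R]_n) : R :=
  'd (F \o chart_inv (chart_at S p)) (chart_at S p p) v.

(* The i-th coordinate vector of the chart c at the point chart_inv c x. *)
Definition coord_vector (c : chart R n M) (i : 'I_n) (x : 'rV[R]_n) :
    'rV[R]_n :=
  'd (chart_at S (chart_inv c x) \o chart_inv c) x (delta_mx 0 i).

Definition form_coord (w : M -> 'rV[R]_n -> 'rV[R]_n -> R)
    (c : chart R n M) (i j : 'I_n) (x : 'rV[R]_n) : R :=
  w (chart_inv c x) (coord_vector c i x) (coord_vector c j x).

(* The coefficient of dx_i /\ dx_j /\ dx_k in dw. *)
Definition ext_diff_coord (w : M -> 'rV[R]_n -> 'rV[R]_n -> R)
    (c : chart R n M) (i j k : 'I_n) (x : 'rV[R]_n) : R :=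
  'D_(delta_mx 0 i) (form_coord w c j k) x
  - 'D_(delta_mx 0 j) (form_coord w c i k) x
  + 'D_(delta_mx 0 k) (form_coord w c i j) x.

(* Nondegeneracy of an alternating form forces n to be even. *)
Record symplecticForm := SymplecticForm {
  symp_form :> M -> 'rV[R]_n -> 'rV[R]_n -> R;
  symp_linearl : forall p v, scalar (symp_form p ^~ v);
  symp_linearr : forall p u, scalar (symp_form p u);
  symp_alternating : forall p u, symp_form p u u = 0;
  symp_nondegenerate : forall p u, (forall v, symp_form p u v = 0) -> u = 0;
  symp_smooth : forall c i j, atlas S c ->
    smooth_on (chart_img c) (form_coord symp_form c i j);
  symp_closed : forall c i j k x, atlas S c -> chart_img c x ->
    ext_diff_coord symp_form c i j k x = 0 }.

Variable w : symplecticForm.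

Definition sgrad (F : M -> R) (p : M) : 'rV[R]_n :=
  xget 0 [set u | forall v, w p u v = - tangent_diff F p v].

Lemma sgradP (F : M -> R) (p : M) (v : 'rV[R]_n) :
  w p (sgrad F p) v = - tangent_diff F p v.
Proof.
pose A := \matrix_(i, j) w p (delta_mx 0 i) (delta_mx 0 j).
have linl v0 : linear (w p ^~ v0 : _ -> R^o) by exact: symp_linearl.
have linr u0 : linear (w p u0 : _ -> R^o) by exact: symp_linearr.
pose Ll v0 := GRing.isLinear.Build R 'rV[R]_n R^o _ _ (linl v0).
pose Lr u0 := GRing.isLinear.Build R 'rV[R]_n R^o _ _ (linr u0).
pose fl v0 : {linear 'rV[R]_n -> R^o} := HB.pack (w p ^~ v0 : _ -> R^o) (Ll v0).
pose fr u0 : {linear 'rV[R]_n -> R^o} :=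
  HB.pack (w p u0 : 'rV[R]_n -> R^o) (Lr u0).
have wE u v0 : w p u v0 = \sum_j (u *m A) 0 j * v0 0 j.
  rewrite -[LHS]/(fr u v0) [in LHS](row_sum_delta v0) linear_sum.
  apply: eq_bigr => j _; rewrite linearZ /= [RHS]mulrC; congr (_ * _).
  rewrite -[LHS]/(fl (delta_mx 0 j) u) [in LHS](row_sum_delta u) linear_sum mxE.
  by apply: eq_bigr => i _; rewrite linearZ mxE.
have Aunit : A \in unitmx.
  rewrite -row_free_unit -kermx_eq0; apply/eqP/row_matrixP => i.
  rewrite row0; apply: (@symp_nondegenerate w p) => v0.
  rewrite wE big1// => j _.
  by rewrite -row_mul mulmx_ker row0 mxE mul0r.
pose d := 'd (F \o chart_inv (chart_at S p) : _ -> R^o) (chart_at S p p).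
pose g := \row_j (- d (delta_mx 0 j)).
have Pg v0 : w p (g *m invmx A) v0 = - tangent_diff F p v0.
  rewrite wE mulmxKV// -[tangent_diff _ _ _]/(d v0).
  rewrite {2}(row_sum_delta v0) linear_sum -sumrN.
  by apply: eq_bigr => j _; rewrite mxE linearZ mulNr mulrC.
by rewrite /sgrad; case: xgetP => [u _|/(_ (g *m invmx A)) []//]; exact.
Qed.

Definition poisson_bracket (F G : M -> R) (p : M) : R :=
  w p (sgrad G p) (sgrad F p).

End manifold.

(* For a continuous function with compact support on a nonempty M, this
   supremum is a maximum. *)
Definition unif_norm {R : realType} {M : Type} (F : M -> R) : R :=
  sup [set `|F p| | p in [set: M]].

Definition unif_dist {R : realType} {M : Type}
    (FG HK : (M -> R) * (M -> R)) : R :=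
  unif_norm (FG.1 \- HK.1) + unif_norm (FG.2 \- HK.2).

Section profile.
Context {R : realType} {n : nat} {M : topologicalType}.
Context {S : smoothManifold R n M}.
Variable w : symplecticForm S.

Definition almost_commuting (s : R) : set ((M -> R) * (M -> R)) :=
  [set HK | [/\ Cinfty_c S HK.1, Cinfty_c S HK.2 &
                unif_norm (poisson_bracket w HK.1 HK.2) <= s]].

Definition profile (F G : M -> R) (s : R) : R :=
  inf [set unif_dist (F, G) HK | HK in almost_commuting s].

End profile.

(* Main.v *)
(* If {H, K} is at most s in norm and a, b lie in [0, 1], then {aH, bK} is at
   most abs, while ||F - aH|| <= ||F - H|| + (1 - a) ||F||, and likewise for G.
   Write m = min(||F||, ||G||) and rho for the profile.  Scaling one of the two
   functions by 0 gives rho <= m; scaling one by t/s gives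
   rho(t) <= rho(s) + (1 - t/s) m for 0 < t <= s.  As rho is nonincreasing,
   these bounds give |s rho(s) - t rho(t)| <= (s - t) m, so that even the
   constant m would do. *)
Require Import Defs.
From mathcomp Require Import all_boot all_order all_algebra.
From mathcomp Require Import all_classical all_reals all_analysis.
From mathcomp Require Import ring lra.
Import Order.TTheory GRing.Theory Num.Theory.
Import numFieldNormedType.Exports.
Local Open Scope classical_set_scope.
Local Open Scope ring_scope.

(** * Scaling of derivatives and of scalar maps *)

(* [derive] is total: at a point of non-differentiability it is the junk value
   [0], which is also compatible with scaling. *)
Lemma derive_scale {R : realType} {V : normedModType R} (f : V -> R) (c : R)
    (v : V) : 'D_v (c *: f) = c *: 'D_v f.
Proof.
apply/funext => x; have [->|c0] := eqVneq c 0.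
  by rewrite !scale0r derive_cst.
have [dfx|ndfx] := pselect (derivable f x v).
  exact: deriveZ.
rewrite /= [RHS]/(c *: _) /derive dvgP; last first.
  move=> dcf; apply: ndfx.
  have : derivable (c^-1 *: (c *: f)) x v by exact: derivableZ.
  by rewrite scalerA mulVf// scale1r.
by rewrite dvgP//; exact/esym/scaler0.
Qed.

Lemma smooth_on_scale {R : realType} {V : normedModType R} (U : set V)
    (f : V -> R) (c : R) : smooth_on U f -> smooth_on U (c *: f).
Proof.
move=> sf k; elim: k f {sf}(sf k) => [|k IH] f /= Cf.
  by move=> x Ux; apply: continuousZl_tmp; exact: Cf.
case: Cf => df Cf; split=> [x Ux|v]; first exact/differentiableZ/df.
by rewrite derive_scale; exact: IH.
Qed.

Lemma scalar_scale {R : pzRingType} {V : lmodType R} {f : V -> R} :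
  scalar f -> forall a u, f (a *: u) = a * f u.
Proof.
move=> lf a u; have f0 : f 0 = 0.
  have := lf (-1) 0 0; rewrite scaler0 addr0 mulN1r => f00.
  by rewrite f00 addNr.
by rewrite -[a *: u]addr0 lf f0 addr0.
Qed.

(** * The uniform norm under scaling *)

Section unif_norm.
Context {R : realType} {T : Type}.
Implicit Types F H : T -> R.

(** [sup] defaults to 0 on an unbounded set, so [unif_norm F] dominates the values of [F] only under
    this condition. *)
Definition sup_bounded F := has_ubound [set `|F p| | p in [set: T]].

Lemma unif_norm_ge0 F : 0 <= unif_norm F.
Proof.
have [[[_ [p _ _]] ub]|nsup] :=
  pselect (has_sup [set `|F p| | p in [set: T]]); last first.
  by rewrite /unif_norm sup_out.
by apply: (le_trans (normr_ge0 (F p))); apply: ub_le_sup => //; exists p.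
Qed.

Lemma unif_norm_ub F p : sup_bounded F -> `|F p| <= unif_norm F.
Proof. by move=> bF; apply: ub_le_sup => //; exists p. Qed.

Lemma unif_norm_le F x : 0 <= x -> (forall p, `|F p| <= x) -> unif_norm F <= x.
Proof.
move=> x0 Fx; have [[p]|T0] := pselect (inhabited T).
  by apply: ge_sup => [|_ [q _ <-]//]; exists `|F p|, p.
(* On an empty [T] the supremum is the default 0, which [x] dominates. *)
rewrite /unif_norm (_ : image _ _ = set0) ?sup0// -subset0 => ? [p _ _].
by case: T0; exists.
Qed.

Lemma unif_norm0 : unif_norm (0 : T -> R) = 0.
Proof.
apply/eqP; rewrite eq_le unif_norm_ge0 andbT.
by apply: unif_norm_le => // p; rewrite normr0.
Qed.

Lemma sup_boundedB F H : sup_bounded F -> sup_bounded H -> sup_bounded (F \- H).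
Proof.
move=> [a Fa] [b Hb]; exists (a + b) => _ [p _ <-].
apply: (le_trans (ler_normB _ _)).
by apply: lerD; [apply: Fa|apply: Hb]; exists p.
Qed.

Lemma sup_bounded_scale F c : sup_bounded F -> sup_bounded (c *: F).
Proof.
move=> bF; exists (`|c| * unif_norm F) => _ [p _ <-].
by rewrite normrM ler_wpM2l// unif_norm_ub.
Qed.

(* An unbounded [F] has the junk norm [0], and so does [c *: F]. *)
Lemma unif_normZ F c : unif_norm (c *: F) = `|c| * unif_norm F.
Proof.
have [->|c0] := eqVneq c 0; first by rewrite scale0r unif_norm0 normr0 mul0r.
have leZ H a : sup_bounded H -> unif_norm (a *: H) <= `|a| * unif_norm H.
  move=> bH; apply: unif_norm_le => [|p].
    by rewrite mulr_ge0// unif_norm_ge0.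
  by rewrite normrM ler_wpM2l// unif_norm_ub.
have FE : F = c^-1 *: (c *: F) by rewrite scalerA mulVf// scale1r.
have [bF|nF] := pselect (sup_bounded F).
  apply/eqP; rewrite eq_le leZ//=.
  rewrite mulrC -ler_pdivlMr ?normr_gt0// mulrC -normfV [in leLHS]FE.
  exact/leZ/sup_bounded_scale.
rewrite /unif_norm !sup_out ?mulr0// => -[_ //].
by move=> bcF; apply: nF; rewrite FE; exact: sup_bounded_scale.
Qed.

(** Pointwise, [F - a H] is the convex combination [a (F - H) + (1 - a) F]. *)
Lemma unif_norm_sub_scale F H (a : R) : sup_bounded F -> sup_bounded H ->
  0 <= a <= 1 ->
  unif_norm (F \- a *: H) <= unif_norm (F \- H) + (1 - a) * unif_norm F.
Proof.
move=> bF bH /andP[a0 a1].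
apply: unif_norm_le => [|p].
  by rewrite addr_ge0 ?mulr_ge0 ?unif_norm_ge0// subr_ge0.
have -> : (F \- a *: H) p = a * (F \- H) p + (1 - a) * F p.
  have <- : F p - a * H p = a * (F p - H p) + (1 - a) * F p by ring.
  by [].
apply: (le_trans (ler_normD _ _)); rewrite !normrM (ger0_norm a0).
rewrite (@ger0_norm _ (1 - a)) ?subr_ge0//; apply: lerD.
  apply: (@le_trans _ _ (1 * `|(F \- H) p|)); first by rewrite ler_wpM2r.
  by rewrite mul1r unif_norm_ub//; exact: sup_boundedB.
by rewrite ler_wpM2l ?subr_ge0// unif_norm_ub.
Qed.

End unif_norm.

(** * Test functions and the Poisson bracket under scaling *)

Section test_functions.
Context {R : realType} {n : nat} {M : topologicalType}.
Variable S : smoothManifold R n M.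

Lemma smooth_fun_continuous (F : M -> R) : smooth_fun S F -> continuous F.
Proof.
move=> sF p; pose c := chart_at S p.
have cp : chart_dom c p by exact: chart_at_dom.
have cFc : {for c p, continuous (F \o chart_inv c)}.
  by apply: (sF c (chart_at_atlas S p) 0%N); exists p.
have cFcc : {for p, continuous ((F \o chart_inv c) \o c)}.
  by apply: continuous_comp => //; exact: chart_map_continuous.
have near_eq : \forall q \near p, ((F \o chart_inv c) \o c) q = F q.
  have : nbhs p (chart_dom c).
    by apply: open_nbhs_nbhs; split=> //; exact: chart_dom_open.
  by apply: filterS => q cq /=; rewrite chart_mapK.
rewrite /prop_for /continuous_at -(nbhs_singleton near_eq).
exact: cvg_trans (near_eq_cvg near_eq) cFcc.
Qed.

Lemma Cinfty_c_bounded (F : M -> R) : Cinfty_c S F -> sup_bounded F.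
Proof.
move=> [sF cF].
have : compact (F @` closure [set p | F p != 0]).
  apply: continuous_compact => //.
  exact/continuous_subspaceT/smooth_fun_continuous.
(* Every number above [B] bounds [F] on the support; [|B| + 1] is also nonnegative, which covers the
   zeros of [F]. *)
move=> /compact_bounded[B [_ FB]]; exists (`|B| + 1) => _ [p _ <-].
have [->|Fp0] := eqVneq (F p) 0; first by rewrite normr0 addr_ge0.
apply: FB; first by rewrite (le_lt_trans (ler_norm B))// ltrDl.
by exists p => //; exact: subset_closure.
Qed.

Lemma Cinfty_c_scale (F : M -> R) (a : R) : Cinfty_c S F -> Cinfty_c S (a *: F).
Proof.
move=> [sF cF]; split=> [c /sF|]; first exact: smooth_on_scale.
apply: (subclosed_compact _ cF); first exact: closed_closure.
apply: closure_subset => p /=; apply: contra_neq => Fp0.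
by have -> : (a *: F) p = a * F p by []; rewrite Fp0 mulr0.
Qed.

Variable w : symplecticForm S.

(** Nondegeneracy makes the Hamiltonian vector unique, so it suffices to pair both sides with every
    [v]. Smoothness gives the differentiability that makes ['d] homogeneous. *)
Lemma sgrad_scale (F : M -> R) (a : R) (p : M) : smooth_fun S F ->
  sgrad w (a *: F) p = a *: sgrad w F p.
Proof.
move=> sF; apply/eqP; rewrite -subr_eq0; apply/eqP.
apply: (symp_nondegenerate (s := w) (p := p)) => v.
rewrite addrC -scaleN1r symp_linearl sgradP.
have -> : w p (a *: sgrad w F p) v = a * w p (sgrad w F p) v.
  exact: scalar_scale (symp_linearl w p v) _ _.
rewrite sgradP /tangent_diff; set c := chart_at S p.
have dF : differentiable (F \o chart_inv c) (c p).
  apply: (proj1 (sF c (chart_at_atlas S p) 1%N)).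
  by exists p => //; exact: chart_at_dom.
have -> : (a *: F) \o chart_inv c = a *: (F \o chart_inv c) by [].
rewrite diffZ//=.
by rewrite mulN1r mulrN opprK [_ *: _]mulrC mulrC subrr.
Qed.

Lemma poisson_bracket_scale (F G : M -> R) (a b : R) :
  smooth_fun S F -> smooth_fun S G ->
  poisson_bracket w (a *: F) (b *: G) = (a * b) *: poisson_bracket w F G.
Proof.
move=> sF sG; apply/funext => p; rewrite /poisson_bracket !sgrad_scale//.
have -> : w p (b *: sgrad w G p) (a *: sgrad w F p) =
    a * (b * w p (sgrad w G p) (sgrad w F p)).
  rewrite (scalar_scale (symp_linearr w p (b *: sgrad w G p))).
  by congr (_ * _); exact: scalar_scale (symp_linearl w p _) _ _.
by rewrite mulrA.
Qed.

End test_functions.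

(** * Estimates for the profile function *)

Section profile.
Context {R : realType} {n : nat} {M : topologicalType}.
Context {S : smoothManifold R n M}.
Variables (w : symplecticForm S) (F G : M -> R).
Hypotheses (hF : Cinfty_c S F) (hG : Cinfty_c S G).

Lemma profile_le_dist s HK : almost_commuting w s HK ->
  profile w F G s <= unif_dist (F, G) HK.
Proof.
move=> sHK; apply: ge_inf; last by exists HK.
by exists 0 => _ [? _ <-]; rewrite addr_ge0// unif_norm_ge0.
Qed.

(** The competitor at level [t] is [(a *: H, b *: K)]: its bracket is [a * b] times that of
    [(H, K)], and each factor costs one convexity term. *)
Lemma profile_le_scale {s} (t a b : R) {H K} : almost_commuting w s (H, K) ->
  0 <= a <= 1 -> 0 <= b <= 1 -> a * b * s <= t ->
  profile w F G t <=
  unif_dist (F, G) (H, K) + (1 - a) * unif_norm F + (1 - b) * unif_norm G.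
Proof.
move=> [/= hH hK HKs] a01 b01 abs.
apply: (@le_trans _ _ (unif_dist (F, G) (a *: H, b *: K))).
  apply: profile_le_dist; split => /=; [exact: Cinfty_c_scale..|].
  rewrite poisson_bracket_scale; [|by case: hH|by case: hK].
  have ab0 : 0 <= a * b.
    by case/andP: a01 => a0 _; case/andP: b01 => b0 _; rewrite mulr_ge0.
  rewrite unif_normZ (ger0_norm ab0); apply: le_trans abs.
  exact: ler_wpM2l.
rewrite /unif_dist /= -addrA [leRHS]addrACA.
by apply: lerD; apply: unif_norm_sub_scale => //; apply: (Cinfty_c_bounded S).
Qed.

Lemma almost_commuting_self :
  almost_commuting w (unif_norm (poisson_bracket w F G)) (F, G).
Proof. by []. Qed.

Lemma unif_dist_self : unif_dist (F, G) (F, G) = 0.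
Proof.
have z (H : M -> R) : H \- H = 0 by apply/funext => p; exact: subrr.
by rewrite /unif_dist /= !z unif_norm0 addr0.
Qed.

Lemma profile_le_min {s : R} : 0 <= s ->
  profile w F G s <= Num.min (unif_norm F) (unif_norm G).
Proof.
move=> s0; rewrite le_min; apply/andP; split.
  (* Starting from [(F, G)] itself at distance 0, the factor 0 kills the bracket and costs exactly
     [unif_norm F]. *)
  have := @profile_le_scale _ s 0 1 _ _ almost_commuting_self.
  rewrite !mul0r unif_dist_self subr0 subrr mul1r mul0r add0r addr0.
  by rewrite !lexx ler01; apply.
have := @profile_le_scale _ s 1 0 _ _ almost_commuting_self.
rewrite mulr0 mul0r unif_dist_self subr0 subrr mul1r mul0r !add0r.
by rewrite !lexx ler01; apply.
Qed.

Lemma profile_ge0 (s : R) : 0 <= profile w F G s.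
Proof.
have [[[y Ey] _]|ninf] := pselect
    (has_inf [set unif_dist (F, G) HK | HK in almost_commuting w s]).
  apply: lb_le_inf => [|_ [? _ <-]]; first by exists y.
  by rewrite addr_ge0// unif_norm_ge0.
by rewrite /profile inf_out.
Qed.

Lemma le_profile (s : R) c : 0 <= s ->
  (forall H K, almost_commuting w s (H, K) -> c <= unif_dist (F, G) (H, K)) ->
  c <= profile w F G s.
Proof.
move=> s0 cle; apply: lb_le_inf; last by move=> _ [[H K] /cle HK <-].
(* The infimum of an empty set would be the default 0; the pair [(0, G)] commutes, so it lies at
   every level [s >= 0]. *)
exists (unif_dist (F, G) (0 *: F, G)), (0 *: F, G) => //.
split => //=; first exact: Cinfty_c_scale.
rewrite -[G]scale1r poisson_bracket_scale; [|by case: hF|by case: hG].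
by rewrite mul0r scale0r unif_norm0.
Qed.

Lemma profile_le_shrink {s t : R} : 0 < t -> t <= s ->
  profile w F G t <=
  profile w F G s + (1 - t / s) * Num.min (unif_norm F) (unif_norm G).
Proof.
move=> t0 ts; have s0 : 0 < s by exact: lt_le_trans ts.
have c01 : 0 <= t / s <= 1.
  by rewrite divr_ge0 ?(ltW t0) ?(ltW s0)//= ler_pdivrMr// mul1r.
have c1 : 0 <= (1 : R) <= 1 by rewrite ler01 lexx.
rewrite -lerBlDr; apply: le_profile => [|H K HK]; first exact: ltW.
(* The factor [t / s] carries level [s] to level [t]; it is applied to the slot where [F] or [G] has
   the smaller norm. *)
rewrite lerBlDr; case: (leP (unif_norm F) (unif_norm G)) => _.
  have := @profile_le_scale s t (t / s) 1 _ _ HK c01 c1.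
  by rewrite mulr1 divfK ?gt_eqF// subrr mul0r addr0; apply.
have := @profile_le_scale s t 1 (t / s) _ _ HK c1 c01.
by rewrite mul1r divfK ?gt_eqF// subrr mul0r addr0; apply.
Qed.

Lemma profile_antimono {s t : R} : 0 <= t -> t <= s ->
  profile w F G s <= profile w F G t.
Proof.
move=> t0 ts; apply: le_profile => // H K [/= hH hK HK].
by apply: profile_le_dist; split=> //=; exact: le_trans ts.
Qed.

Lemma mul_profile_dist {s t : R} : 0 < t -> t <= s ->
  `|s * profile w F G s - t * profile w F G t| <=
  (s - t) * Num.min (unif_norm F) (unif_norm G).
Proof.
move=> t0 ts; have s0 : 0 < s by exact: lt_le_trans ts.
have := profile_le_min (ltW s0); have := profile_le_shrink t0 ts.
have := profile_antimono (ltW t0) ts; have := profile_ge0 s.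
set m := Num.min _ _; set x := profile w F G s; set y := profile w F G t.
move=> x0 xy yx xm; have m0 : 0 <= m by exact: le_trans xm.
rewrite ler_norml; apply/andP; split.
  (* Lower bound: [t (1 - t / s) <= s (1 - t / s) = s - t] since [t <= s], and [t x <= s x] since
     [x >= 0]. *)
  have : t * y <= t * x + t * (1 - t / s) * m by rewrite -mulrA -mulrDr ler_pM2l.
  have : t * (1 - t / s) * m <= (s - t) * m.
    apply: ler_wpM2r => //.
    have -> : s - t = s * (1 - t / s) by field; rewrite gt_eqF.
    by rewrite ler_wpM2r// subr_ge0 ler_pdivrMr// mul1r.
  have : t * x <= s * x by rewrite ler_wpM2r.
  lra.
(* Upper bound: in [s x - t y = (s - t) x + t (x - y)], the last term is nonpositive and
   [x <= m]. *)
have : t * x <= t * y by rewrite ler_pM2l.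
have : (s - t) * x <= (s - t) * m by rewrite ler_wpM2l// subr_ge0.
lra.
Qed.

End profile.

Theorem proposition1p6 (R : realType) (n : nat) (M : topologicalType)
    (S : smoothManifold R n M) (w : symplecticForm S)
    (connM : connected [set: M])
    (F G : M -> R) (hF : Cinfty_c S F) (hG : Cinfty_c S G) :
  (3 * Num.min (unif_norm F) (unif_norm G)).-lipschitz_[set s : R | 0 < s]
    (fun s : R => s * profile w F G s).
Proof.
have m0 : 0 <= Num.min (unif_norm F) (unif_norm G).
  by rewrite le_min !unif_norm_ge0.
(* Nonnegativity of the minimum lets the bound of [mul_profile_dist] be relaxed to the factor 3. *)
have {}m0 : Num.min (unif_norm F) (unif_norm G) <=
    3 * Num.min (unif_norm F) (unif_norm G) by lra.
move=> [s t] [/= s0 t0].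
wlog ts : s t s0 t0 / t <= s.
  move=> th; have [/th|/ltW/th] := leP t s; first exact.
  by rewrite distrC (distrC t); exact.
rewrite (ger0_norm (_ : 0 <= s - t)) ?subr_ge0//.
apply: (le_trans (mul_profile_dist w F G hF hG t0 ts)).
by rewrite mulrC ler_wpM2r// subr_ge0.
Qed.
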